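(* Let $G$ be a connected graph of order $n$ and independence number $\alpha$, where $n \ge 2\alpha$ and $\alpha \ge 1$. Then $G$ has a spanning tree $T$ with $$\mu(T) < \alpha + 1.$$
   Context: For a connected graph $H$ on $n$ vertices, $d_H(u,v)$ denotes the distance between $u$ and $v$ in $H$, and the average distance is $\mu(H)=\binom{n}{2}^{-1}\sum_{\{u,v\}\subset V(H)} d_H(u,v)$. The independence number of a graph is the maximum cardinality of a set of pairwise non-adjacent vertices. *)

(* Defs.v *)
From HB Require Import structures.
From mathcomp Require Import all_boot all_order all_algebra.

Set Implicit Arguments.
Unset Strict Implicit.
Unset Printing Implicit Defensive.

Import Order.TTheory GRing.Theory Num.Theory.
Local Open Scope ring_scope.

Record sgraph (V : finType) := SGraph {
  adj :> rel V;
  adj_sym : symmetric adj;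
  adj_irrefl : irreflexive adj
}.

Section Graphs.
Variable V : finType.
Implicit Types G T : sgraph V.

(* The empty graph also satisfies this predicate. *)
Definition connected_graph G : Prop := forall u v : V, connect G u v.

Definition independent G (S : {set V}) : bool :=
  [forall u in S, forall v in S, ~~ G u v].

Definition independence_number G : nat :=
  (\max_(S : {set V} | independent G S) #|S|)%N.

Definition has_walk G (u v : V) (k : nat) : bool :=
  [exists p : k.-tuple V, path G u p && (last u p == v)].

(* The least length of a walk from u to v. A shortest walk has fewer than #|V| *)
(* edges, so the search range is exhaustive; the value is #|V| when u and v    *)
(* lie in different components.                                                *)
Definition dist G (u v : V) : nat := find (has_walk G u v) (iota 0 #|V|).

(* Comparing enumeration ranks selects each unordered pair {u, v} exactly once. *)
Definition average_distance G : rat :=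
  ('C(#|V|, 2))%:R^-1 *
  \sum_(p : V * V | (enum_rank p.1 < enum_rank p.2)%N) (dist G p.1 p.2)%:R.

(* Sequences of size 2 are excluded: every edge u v gives the ucycle [:: u; v]. *)
Definition acyclic_graph G : Prop :=
  forall c : seq V, (2 < size c)%N -> ~ ucycle G c.

Definition is_tree T : Prop := connected_graph T /\ acyclic_graph T.

(* Spanning is built in: T and G have the same vertex type. *)
Definition spanning_tree G T : Prop := is_tree T /\ subrel T G.

End Graphs.

(* Main.v *)
Require Import Defs.
From mathcomp Require Import all_boot all_order all_algebra.
From mathcomp Require Import zify.

(** A connected graph has a connected dominating set [C] with fewer than
    [2 alpha] vertices: grow an independent set [A] by repeatedly adding a vertex
    at distance exactly two from [A], and let [C] collect [A] together with the
    intermediate vertices.  Extend a spanning tree of [C] to the whole graph by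
    attaching every other vertex as a leaf.  The sum of all distances in a tree is
    the sum over its edges of the product of the orders of the two components left
    by deleting the edge.  This product is [n - 1] for the leaf edges, and at most
    [n ^ 2 / 4] for the at most [2 alpha - 2] edges inside [C]. *)

Import GRing.Theory Num.Theory.

Set Implicit Arguments.
Unset Strict Implicit.
Unset Printing Implicit Defensive.

(** * Distances and edges leaving a vertex set *)

Section Distances.
Variables (V : finType) (G : sgraph V).

Lemma dist_le_path (u : V) (p : seq V) : path G u p -> dist G u (last u p) <= size p.
Proof.
move=> pp; rewrite /dist; have [le_np|lt_pn] := leqP #|V| (size p).
  (* [dist] is at most [#|V|], the length of its search range, so a walk at least that long needs no
     shortening. *)
  by apply: leq_trans le_np; rewrite -[X in _ <= X](size_iota 0); apply: find_size.
have walk : has_walk G u (last u p) (size p).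
  by apply/existsP; exists (in_tuple p); rewrite pp eqxx.
rewrite leqNgt; apply/negP => /(before_find 0).
by rewrite nth_iota // add0n walk.
Qed.

Lemma connected_crossing_edge (P : {set V}) (a z : V) :
  connected_graph G -> a \in P -> z \notin P ->
  exists2 y, y \in P & exists2 x, x \notin P & G y x.
Proof.
move=> cG aP zP.
have [/existsP [y /andP [yP /existsP [x /andP [xP Gyx]]]]|none] :=
  boolP [exists y in P, exists x, (x \notin P) && G y x].
  by exists y => //; exists x.
have clP : closed G P.
  apply: intro_closed => [u v|x y Gxy xP]; first exact: (sym_connect_sym (@adj_sym _ G)).
  apply: contraNT none => yP; apply/existsP; exists x; rewrite xP.
  by apply/existsP; exists y; rewrite yP.
by rewrite -(closed_connect clP (cG a z)) aP in zP.
Qed.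

End Distances.

(** * Trees given by a parent function *)

Section ParentTree.
Variables (V : finType) (r : V) (par : V -> V) (rk : V -> nat).
Hypotheses (par_root : par r = r) (rk_root : rk r = 0).
Hypothesis rk_par : forall x, x != r -> rk (par x) < rk x.

(** The condition [u != v] discards the loop that [par r = r] would create at the root. *)
Definition parent_rel : rel V :=
  [rel u v | (u != v) && ((par u == v) || (par v == u))].

Lemma parent_rel_sym : symmetric parent_rel.
Proof. by move=> u v; rewrite /parent_rel /= eq_sym orbC. Qed.

Lemma parent_rel_irrefl : irreflexive parent_rel.
Proof. by move=> u; rewrite /parent_rel /= eqxx. Qed.

Definition parent_tree : sgraph V := SGraph parent_rel_sym parent_rel_irrefl.

Lemma parent_tree_edge x : x != r -> parent_tree x (par x).
Proof.
move=> xr; rewrite /= /parent_rel /= eqxx andbT.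
by apply: contraTneq (rk_par xr) => <-; rewrite ltnn.
Qed.

Lemma rk_gt0 x : x != r -> 0 < rk x.
Proof. by move/rk_par; apply: leq_ltn_trans. Qed.

Lemma parent_tree_connected : connected_graph parent_tree.
Proof.
have toroot x : connect parent_tree x r.
  have [m] := ubnP (rk x); elim: m x => // m IH x lt_xm.
  have [->|xr] := eqVneq x r; first exact: connect0.
  apply: connect_trans (connect1 (parent_tree_edge xr)) (IH _ _).
  by apply: leq_trans (rk_par xr) _.
move=> u v; apply: connect_trans (toroot u) _.
by rewrite (sym_connect_sym parent_rel_sym) toroot.
Qed.

Lemma parent_tree_edge_top x y : parent_tree x y -> rk y <= rk x -> y = par x.
Proof.
case/andP=> xy /orP[/eqP-> //|/eqP eyx] le_yx.
have yr : y != r by apply: contraNneq xy => er; rewrite -eyx er par_root.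
by move: (rk_par yr); rewrite eyx ltnNge le_yx.
Qed.

(* Both neighbours on a cycle of its vertex of largest rank would be the parent. *)
Lemma parent_tree_acyclic : acyclic_graph parent_tree.
Proof.
case=> // z c0; set c := z :: c0 => szc /andP [cyc uc].
have zc : z \in c by rewrite mem_head.
case: (@arg_maxnP _ z (mem c) rk zc) => x xc xmax.
have [i c' ec] := rot_to xc.
have : cycle parent_tree (x :: c') by rewrite -ec rot_cycle.
have : uniq (x :: c') by rewrite -ec rot_uniq.
have memc y : y \in x :: c' -> rk y <= rk x.
  by rewrite -ec mem_rot => yc; apply: xmax.
have : size (x :: c') > 2 by rewrite -ec size_rot.
clear ec.
case: c' memc => // y c'; case/lastP: c' => // c' w memc _.
rewrite /= rcons_path last_rcons mem_rcons inE.
case/and3P => _ /norP[/negP yw _] _ /and3P[xy _ wx].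
case: yw; apply/eqP.
rewrite [LHS](parent_tree_edge_top xy); last by rewrite memc // !inE eqxx orbT.
rewrite [RHS](@parent_tree_edge_top x w) //; first by rewrite adj_sym.
by rewrite memc // !inE mem_rcons inE eqxx !orbT.
Qed.

(** A vertex [w != r] stands for the edge from [w] to [par w]. Thus [ancestors x], which contains
    [x] itself when [x != r], encodes the edges of the path from [x] to the root. *)
Definition ancestors x := [set w | (w != r) && fconnect par x w].

Lemma ancestors_root : ancestors r = set0.
Proof.
have iter_root k : iter k par r = r by elim: k => //= k ->.
apply/setP => w; rewrite !inE; apply/negP => /andP[wr /iter_findex].
by rewrite iter_root => rw; rewrite rw eqxx in wr.
Qed.

Lemma ancestors_par x : x != r -> ancestors x = x |: ancestors (par x).
Proof.
move=> xr; apply/setP => w; rewrite !inE fconnect_eqVf (eq_sym w x).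
by have [<-|] := eqVneq x w; rewrite ?xr.
Qed.

Lemma rk_ancestors x w : w \in ancestors x -> rk w <= rk x ?= iff (w == x).
Proof.
have [m] := ubnP (rk x); elim: m x => // m IH x lt_xm.
have [->|xr] := eqVneq x r; first by rewrite ancestors_root inE.
rewrite ancestors_par // in_setU1 => /predU1P[->|wx]; first by rewrite eqxx; apply/leqif_refl.
have lt : rk w < rk x.
  apply: leq_ltn_trans (rk_par xr); apply: IH => //.
  by apply: leq_trans (rk_par xr) _.
split; first exact: ltnW.
by rewrite (ltn_eqF lt); apply/esym; apply: contraTF lt => /eqP->; rewrite ltnn.
Qed.

(** The tree path from [u] to [v] uses the edges lying on exactly one of the two root paths. It is
    built by repeatedly moving the endpoint of larger rank to its parent. *)
Lemma parent_tree_path u v :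
  exists p, [/\ path parent_tree u p, last u p = v &
    size p <= \sum_(w | w != r) ((w \in ancestors u) (+) (w \in ancestors v))].
Proof.
pose f u v := \sum_(w | w != r) ((w \in ancestors u) (+) (w \in ancestors v)).
have fsym x y : f x y = f y x by apply: eq_bigr => w _; rewrite addbC.
(* By rank, [x] is an ancestor of neither [y] nor [par x], so passing from [x] to [par x] loses
   exactly the term at [w = x]. *)
have fstep x y : x != r -> x != y -> rk y <= rk x -> f x y = (f (par x) y).+1.
  move=> xr xy le_yx.
  have xNy : x \notin ancestors y.
    by apply: contra xy => /rk_ancestors [le_xy <-]; rewrite eqn_leq le_xy.
  have xNp : x \notin ancestors (par x).
    by apply: contraTN (rk_par xr) => /rk_ancestors [le_xp _]; rewrite -leqNgt.
  rewrite /f (bigD1 x) //= [in RHS](bigD1 x) //= (negPf xNy) (negPf xNp).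
  rewrite ancestors_par // !inE eqxx /= add0n add1n; congr _.+1.
  by apply: eq_bigr => w /andP[_ wx]; rewrite !inE (negPf wx).
rewrite -/(f u v).
have [m] := ubnP (rk u + rk v); elim: m u v => // m IH u v lt_m.
have [->|uv] := eqVneq u v; first by exists [::].
have [le_vu|lt_uv] := leqP (rk v) (rk u).
  have ur : u != r.
    apply: contraNneq uv => eu; apply/eqP; rewrite eu; apply/esym/eqP.
    apply: contraTT le_vu => vr; rewrite -ltnNge eu rk_root; exact: rk_gt0.
  have lt_pu := rk_par ur.
  have [|p [pp lp sp]] := IH (par u) v; first by lia.
  exists (par u :: p); split=> //; last by rewrite (fstep u v).
  by rewrite [path _ _ _]/= pp andbT; apply: parent_tree_edge.
have vr : v != r by apply: contraTneq lt_uv => ->; rewrite rk_root.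
have lt_pv := rk_par vr.
have [|p [pp lp sp]] := IH u (par v); first by lia.
exists (rcons p v); split; rewrite ?last_rcons //.
  by rewrite rcons_path pp lp adj_sym; apply: parent_tree_edge.
have vu : v != u by rewrite eq_sym.
by rewrite size_rcons fsym (fstep v u vr vu (ltnW lt_uv)) fsym.
Qed.

(** For [w != r], this is the component containing [w] once the edge from [w] to [par w] is
    deleted. *)
Definition descendants w := [set x | w \in ancestors x].

(** Double counting: the edge at [w] contributes to the pairs that [descendants w] separates. *)
Lemma sum_dist_parent_tree :
  \sum_(p : V * V | enum_rank p.1 < enum_rank p.2) dist parent_tree p.1 p.2 <=
  \sum_(w | w != r) #|descendants w| * #|~: descendants w|.
Proof.
apply: (@leq_trans (\sum_(p : V * V | enum_rank p.1 < enum_rank p.2)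
   \sum_(w | w != r) ((w \in ancestors p.1) (+) (w \in ancestors p.2)))).
  apply: leq_sum => -[u v] _ /=.
  have [p [pp <- sp]] := parent_tree_path u v.
  exact: leq_trans (dist_le_path pp) sp.
rewrite exchange_big /=; apply: leq_sum => w _.
set D := descendants w.
have inD x : (w \in ancestors x) = (x \in D) by rewrite [RHS]inE.
pose f (p : V * V) : nat := (p.1 \in D) (+) (p.2 \in D).
rewrite (eq_bigr f) => [|p _]; last by rewrite !inD.
pose swap (p : V * V) := (p.2, p.1).
have swapK : involutive swap by case.
(* Over ordered pairs, every separated pair is counted twice. *)
have fall : \sum_p f p = 2 * (#|D| * #|~: D|).
  have split_f p : f p = ((p.1 \in D) && (p.2 \in ~: D)) + ((p.2 \in D) && (p.1 \in ~: D)).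
    by rewrite /f !in_setC; case: (p.1 \in D); case: (p.2 \in D).
  rewrite (eq_bigr _ (fun p _ => split_f p)) big_split /= mul2n -addnn.
  rewrite [X in _ + X](reindex_inj (inv_inj swapK)) /= -cardsX -sum1_card.
  by rewrite [in RHS]big_mkcond /=; congr (_ + _); apply: eq_bigr => -[a b] _;
    rewrite in_setX; case: (_ && _).
rewrite -(@leq_pmul2l 2) // -fall.
(* The pairs that are not increasing in rank include the swaps of the increasing ones, so they
   contribute at least as much. *)
rewrite [X in _ <= X](bigID (fun p : V * V => enum_rank p.1 < enum_rank p.2)) /=.
rewrite mul2n -addnn leq_add2l.
rewrite [X in X <= _](reindex_inj (inv_inj swapK)) /=.
rewrite [X in X <= _](eq_bigr f) => [|p _]; last by rewrite /f addbC.
rewrite big_mkcond [X in _ <= X]big_mkcond; apply: leq_sum => p _.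
by case: (ltngtP (enum_rank p.1)).
Qed.

End ParentTree.

(** * Connected dominating sets and the spanning trees they give *)

Section ConnectedDominatingSet.
Variables (V : finType) (G : sgraph V).

(** This is a spanning tree of the subgraph induced by [C], rooted at [r]. The functions [par] and
    [rk] are total, but unconstrained outside [C]. *)
Definition rooted_in (r : V) (C : {set V}) :=
  exists par : V -> V, exists rk : V -> nat,
    [/\ r \in C, par r = r, rk r = 0 &
        forall x, x \in C -> x != r -> [/\ par x \in C, G x (par x) & rk (par x) < rk x]].

Lemma rooted_in_extend r C x y :
  rooted_in r C -> y \in C -> G x y -> rooted_in r (x |: C).
Proof.
move=> rC yC Gxy; have [xC|xC] := boolP (x \in C); first by rewrite (setUidPr _) ?sub1set.
have [par [rk [rinC pr rkr H]]] := rC.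
have neqC z : z \in C -> (z == x) = false by move=> zC; apply: contraNF xC => /eqP <-.
exists [eta par with x |-> y], [eta rk with x |-> (rk y).+1].
split; rewrite /= ?inE ?rinC ?orbT ?(neqC r) // => z.
rewrite !inE => /predU1P[->|zC] zr; first by rewrite eqxx yC orbT neqC.
by have [pzC Gz rz] := H _ zC zr; rewrite (neqC z) // pzC orbT neqC.
Qed.

Lemma independent_extend A x :
  independent G A -> (forall a, a \in A -> ~~ G a x) -> independent G (x |: A).
Proof.
move=> /forall_inP iA xA; apply/forall_inP => u; rewrite !inE => /predU1P[->|uA];
  apply/forall_inP => v; rewrite !inE => /predU1P[->|vA].
- by rewrite adj_irrefl.
- by rewrite adj_sym xA.
- exact: xA.
- exact: (forall_inP (iA u uA)).
Qed.

Lemma connected_dominating_set (r : V) : connected_graph G ->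
  exists A C : {set V}, [/\ independent G A, rooted_in r C, #|C| < 2 * #|A| &
    forall x, x \notin C -> exists2 y, y \in C & G x y].
Proof.
move=> cG.
(* Induction on the number of vertices outside [A], starting from [A] and [C] both equal to
   [[set r]]. *)
suff: forall m (A C : {set V}), #|V| - #|A| < m -> r \in A -> A \subset C ->
    independent G A -> rooted_in r C -> #|C| < 2 * #|A| ->
    exists A' C' : {set V}, [/\ independent G A', rooted_in r C', #|C'| < 2 * #|A'| &
    forall x, x \notin C' -> exists2 y, y \in C' & G x y].
  apply; first exact: ltnSn; first exact: set11; first exact: subxx; last by rewrite cards1.
    apply/forall_inP => u /set1P ->; apply/forall_inP => v /set1P ->.
    by rewrite adj_irrefl.
  exists id, (fun _ => 0); split; rewrite ?set11 // => x.
  by rewrite !inE => ->.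
elim=> // m IH A C lt_m rA sAC iA rC szC.
pose P := [set x | (x \in A) || [exists a in A, G a x]].
have [/forallP domP|] := boolP [forall x, x \in P].
  exists A, C; split => // x xC; move: (domP x); rewrite inE.
  case/orP => [xA|/exists_inP [a aA Gax]]; first by rewrite (subsetP sAC) in xC.
  by exists a; rewrite ?(subsetP sAC) // adj_sym.
rewrite negb_forall => /existsP [z zP].
have rP : r \in P by rewrite inE rA.
(* [P] is the closed neighbourhood of [A]. An edge leaving it from [y] to [x] cannot start in [A],
   so [y] has a neighbour [a] in [A], and [x] is at distance two from [A]. *)
have [y yP [x xP Gyx]] := connected_crossing_edge cG rP zP.
move: xP; rewrite inE negb_or negb_exists_in => /andP[xA /forall_inP xN].
move: yP; rewrite inE => /orP[yA|/exists_inP[a aA Gay]].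
  by move: (xN y yA); rewrite Gyx.
have aC := subsetP sAC a aA.
have rC1 : rooted_in r (y |: C) by apply: (rooted_in_extend rC aC); rewrite adj_sym.
have rC2 : rooted_in r (x |: (y |: C)).
  by apply: (rooted_in_extend rC1 (setU11 _ _)); rewrite adj_sym.
have cA : #|x |: A| = #|A|.+1 by rewrite cardsU1 xA.
apply: (IH (x |: A) (x |: (y |: C))) => //.
- by move: (max_card (mem (x |: A))) lt_m; rewrite cA; lia.
- by rewrite !inE rA orbT.
- by apply: setUS; apply: subset_trans sAC (subsetUr _ _).
- exact: independent_extend.
(* [#|A|] grows by one and [#|C|] by at most two. *)
by rewrite cA; move: (cardsU1 x (y |: C)) (cardsU1 y C) szC; do 2!case: (_ \notin _); lia.
Qed.

(* The rooted tree on [C] is extended by hanging every vertex outside [C] on a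
   neighbour in [C]; such a vertex is then its only descendant. *)
Lemma spanning_tree_of_dominating_set r C :
  rooted_in r C -> (forall x, x \notin C -> exists2 y, y \in C & G x y) ->
  exists T : sgraph V, spanning_tree G T /\
    4 * \sum_(p : V * V | enum_rank p.1 < enum_rank p.2) dist T p.1 p.2 <=
    #|C|.-1 * #|V| ^ 2 + (#|V| - #|C|) * (4 * #|V|.-1).
Proof.
move=> [par0 [rk0 [rC pr0 rkr0 H]]] domC.
(* The default [r] is never taken for [x] outside [C], by domination. *)
pose nb x := odflt r [pick y | (y \in C) && G x y].
have nbP x : x \notin C -> nb x \in C /\ G x (nb x).
  move=> /domC [y yC Gxy]; rewrite /nb; case: pickP => [z /andP[] //|/(_ y)].
  by rewrite yC Gxy.
pose par x := if x \in C then par0 x else nb x.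
pose rk x := if x \in C then rk0 x else (rk0 (nb x)).+1.
have parC x : par x \in C.
  rewrite /par; case: ifPn => [xC|/nbP[]//].
  by have [->|/H[]//] := eqVneq x r; rewrite pr0.
have pr : par r = r by rewrite /par rC.
have rkr : rk r = 0 by rewrite /rk rC.
have rk_par x : x != r -> rk (par x) < rk x.
  move=> xr; rewrite {1}/rk parC /par /rk; case: ifPn => [xC|xC] //.
  by have [] := H x xC xr.
have Gpar x : x != r -> G x (par x).
  move=> xr; rewrite /par; case: ifPn => [xC|/nbP[]//].
  by have [] := H x xC xr.
exists (parent_tree par); split.
  split; first split.
  - exact: parent_tree_connected rk_par.
  - exact: parent_tree_acyclic pr rk_par.
  have up x y : x != y -> par x = y -> G x y.
    move=> xy pxy; rewrite -pxy; apply: Gpar.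
    by apply: contraNneq xy => er; rewrite -pxy er pr.
  move=> u v /andP[uv /orP[/eqP/up->//|/eqP/up]].
  by rewrite adj_sym; apply; rewrite eq_sym.
apply: leq_trans (leq_mul (leqnn 4) (sum_dist_parent_tree pr rkr rk_par)) _.
rewrite (bigID (mem C)) /= mulnDr; apply: leq_add.
  rewrite big_distrr /=.
  have -> : #|C|.-1 = #|C :\ r| by rewrite (cardsD1 r C) rC.
  rewrite -sum_nat_const.
  rewrite (eq_bigl (fun w => w \in C :\ r)) => [|w]; last by rewrite !inE.
  (* Four times the product of two orders with sum [#|V|] is at most [#|V| ^ 2]. *)
  apply: leq_sum => w _; rewrite -(cardsC (descendants r par w)).
  by case: (nat_AGM2 #|descendants r par w| #|~: descendants r par w|).
have -> : #|V| - #|C| = #|~: C| by rewrite -(cardsC C) addKn.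
rewrite mulnCA leq_mul2l /= -sum_nat_const.
rewrite (eq_bigl (fun w => w \in ~: C)) => [|w]; last first.
  by rewrite !inE andbC; case: eqVneq => [->|]; rewrite ?rC ?andbT.
apply: leq_sum => w; rewrite inE => wC.
suff -> : descendants r par w = [set w] by rewrite cardsC1 cards1 mul1n.
apply/setP => x; rewrite !inE; apply/idP/eqP => [/andP[_ /iter_findex]|->].
  (* All values of [par] lie in [C], so only the zeroth iterate can reach [w]. *)
  case: findex => //= k ek; by rewrite -ek parC in wC.
by rewrite connect0 andbT; apply: contraNneq wC => ->.
Qed.

End ConnectedDominatingSet.

(** * The bound on the average distance *)

Local Open Scope ring_scope.

Theorem theorem4p1 (V : finType) (G : sgraph V) (n alpha : nat) :
  connected_graph G ->
  #|V| = n ->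
  independence_number G = alpha ->
  (2 * alpha <= n)%N ->
  (1 <= alpha)%N ->
  exists T : sgraph V,
    spanning_tree G T /\ average_distance T < alpha%:R + 1.
Proof.
move=> cG cardV indG le_an a_gt0.
have [r _] : exists r : V, r \in V by apply/card_gt0P; rewrite cardV; lia.
have [A [C [iA rC szC domC]]] := connected_dominating_set r cG.
have [T [spT leT]] := spanning_tree_of_dominating_set rC domC.
exists T; split=> //.
have leA : (#|A| <= alpha)%N.
  by rewrite -indG; apply: (@leq_bigmax_cond _ (independent G) (fun S : {set V} => #|S|)).
have binV : ('C(#|V|, 2) * 2 = n * n.-1)%N.
  by rewrite cardV -[X in (_ * X)%N]/(2`!) bin_ffact ffactnS ffactn1.
have bin_gt0 : (0 < 'C(#|V|, 2))%N by rewrite bin_gt0 cardV; lia.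
rewrite /average_distance -natr_sum mulrC ltr_pdivrMr ?ltr0n //.
rewrite natr1 -natrM ltr_nat.
have leC : (#|C| <= n)%N by rewrite -cardV max_card.
move: leT; move: (\sum_(_ | _) _)%N => W; rewrite cardV => leT.
rewrite -(@ltn_pmul2l 4) //; apply: leq_ltn_trans leT _.
have C_gt0 : (0 < #|C|)%N by case: rC => ? [? [? _ _ _]]; apply/card_gt0P; exists r.
move: binV szC leC C_gt0; rewrite cardV; case: #|C| => // c.
set B := 'C(n, 2) => binV szC leC _.
have {leA szC} leca : (c <= 2 * alpha.-1)%N by lia.
case: n {cardV W bin_gt0} @B binV le_an leC => [|[|m]] B binV le_an leC; [lia|lia|].
(* Now [#|C|] is [c.+1] and the order is [n = m + 2]. As [n ^ 2 - 4 (n - 1) = m ^ 2], the bound on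
   [4 * W] equals [c m ^ 2 + 4 (m + 1) ^ 2], which increases with [c]. *)
have mono : (c * m ^ 2 <= 2 * alpha.-1 * m ^ 2)%N by rewrite leq_mul2r leca orbT.
case: alpha a_gt0 {indG leca le_an} mono => // a _ /= mono.
have -> : (4 * (a.+2 * B) = 2 * a.+2 * (m.+2 * m.+1))%N by rewrite -binV; lia.
(* Naming the number [d] of leaves outside [C] removes the truncated subtraction; [prod] then
   supplies the quadratic identity for linear arithmetic. *)
have [d ed] : exists d, (m.+1 = c + d)%N by exists (m.+1 - c)%N; lia.
have -> : (m.+2 - c.+1 = d)%N by lia.
have prod : (m.+1 * m.+1 = (c + d) * m.+1)%N by rewrite -ed.
by move: mono prod; rewrite -!mulnn; clear; lia.
Qed.
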